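(* For any integer $n\geq 1$ let $v(n)$ be the number of associative, quasitrivial, and $\leq_n$-preserving operations $F\colon X_n^2\to X_n$, and set $v(0)=0$. The sequence $(v(n))_{n\geq 0}$ satisfies the second order linear recurrence equation $$v(n+2)-2\,v(n+1)-2\,v(n)=2,\qquad n\geq 0,$$ with $v(0)=0$ and $v(1)=1$, and we have $$3\,v(n)+2=\tfrac{2+\sqrt{3}}{2}(1+\sqrt{3})^n+\tfrac{2-\sqrt{3}}{2}(1-\sqrt{3})^n=\sum_{k\geq 0}3^k\left(2\binom{n}{2k}+3\binom{n}{2k+1}\right),\qquad n\geq 0.$$ Moreover, its generating function is given by $V(z)=z(z+1)/(2z^3-3z+1)$.
   Context: $X_n=\{1,\ldots,n\}$ and $\leq_n$ is the total ordering on $X_n$ with $1<_n 2<_n\cdots<_n n$. An operation $F\colon X_n^2\to X_n$ is associative if $F(F(x,y),z)=F(x,F(y,z))$ for all $x,y,z$; quasitrivial if $F(x,y)\in\{x,y\}$ for all $x,y$; $\leq_n$-preserving if $x\leq_n x'$ and $y\leq_n y'$ imply $F(x,y)\leq_n F(x',y')$. The (ordinary) generating function of a sequence $(s_n)_{n\geq 0}$ is the power series $S(z)=\sum_{n\geq 0}s_n z^n$. *)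

(* Defs.v *)
From mathcomp Require Import all_boot all_order all_algebra.
From mathcomp Require Import classical_sets fsbigop.
Set Implicit Arguments.
Unset Strict Implicit.
Unset Printing Implicit Defensive.
Import Order.TTheory GRing.Theory Num.Theory.
Local Open Scope ring_scope.

(* X_n = {1, ..., n} is represented by 'I_n = {0, ..., n-1}, with its usual
   order. *)
Definition operation (n : nat) := {ffun 'I_n * 'I_n -> 'I_n}.

Definition op_associative n (F : operation n) : bool :=
  [forall x, forall y, forall z, F (F (x, y), z) == F (x, F (y, z))].

Definition quasitrivial n (F : operation n) : bool :=
  [forall x, forall y, (F (x, y) == x) || (F (x, y) == y)].

Definition order_preserving n (F : operation n) : bool :=
  [forall x : 'I_n, forall x' : 'I_n, forall y : 'I_n, forall y' : 'I_n,
    (x <= x')%N && (y <= y')%N ==> (F (x, y) <= F (x', y'))%N].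

(* The value at 0 is a convention: there is exactly one operation on the empty
   set, so the cardinal alone would give 1. *)
Definition v (n : nat) : nat :=
  if n is 0 then 0%N
  else #|[pred F : operation n |
          [&& op_associative F, quasitrivial F & order_preserving F]]|.

(* Formal power series, represented by their sequence of coefficients. *)
Definition fps (A : Type) := nat -> A.

Definition fps_of_poly (A : nzRingType) (p : {poly A}) : fps A :=
  fun n => p`_n.

Definition fps_mul (A : nzRingType) (a b : fps A) : fps A :=
  fun n => \sum_(i < n.+1) a i * b (n - i)%N.

(* The first n coefficients of the multiplicative inverse of a, obtained by
   solving (a * b)_m = (m == 0) for b_m. *)
Fixpoint fps_inv_upto (A : comUnitRingType) (a : fps A) (n : nat) : seq A :=
  if n is m.+1 then
    let s := fps_inv_upto a m in
    rcons s (((m == 0%N)%:R - \sum_(i < m) s`_i * a (m - i)%N) / a 0%N)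
  else [::].

(* Meaningful when the constant coefficient of a is a unit: see fps_mulVr. *)
Definition fps_inv (A : comUnitRingType) (a : fps A) : fps A :=
  fun n => (fps_inv_upto a n.+1)`_n.

Definition fps_div (A : comUnitRingType) (a b : fps A) : fps A :=
  fps_mul a (fps_inv b).

Lemma size_fps_inv_upto (A : comUnitRingType) (a : fps A) n :
  size (fps_inv_upto a n) = n.
Proof. by elim: n => //= n IH; rewrite size_rcons IH. Qed.

Lemma nth_fps_inv_upto (A : comUnitRingType) (a : fps A) n i :
  (i < n)%N -> (fps_inv_upto a n)`_i = fps_inv a i.
Proof.
elim: n => // n IH; rewrite ltnS leq_eqVlt => /orP[/eqP-> //|lt_in].
by rewrite /= nth_rcons size_fps_inv_upto lt_in IH.
Qed.

Lemma fps_mulVr (A : comUnitRingType) (a : fps A) :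
  a 0%N \is a GRing.unit -> fps_mul (fps_inv a) a =1 fps_of_poly 1.
Proof.
move=> a0U n; rewrite /fps_mul /fps_of_poly coef1 big_ord_recr /= subnn.
rewrite {2}/fps_inv /= nth_rcons size_fps_inv_upto ltnn eqxx.
rewrite divrK // addrC.
under [X in _ - X]eq_bigr => i _ do rewrite nth_fps_inv_upto //.
by rewrite subrK.
Qed.

Definition generating_function (s : nat -> nat) : fps int :=
  fun n => (s n)%:Z.

(* Main.v *)
(* An admissible F on a chain with at least two elements, minimum lo and maximum
   hi, is classified by the pair (F(lo, hi), F(hi, lo)).  If both values are lo,
   monotonicity makes lo an annihilator, and F is determined by its restriction
   to the other elements; likewise for hi.  If the values are (lo, hi), then lo
   and hi are left zeros, and associativity and monotonicity leave two options:
   either F is the first projection, or F(x, lo) = lo and F(x, hi) = hi for all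
   inner x, so that F is determined by its restriction to the inner elements;
   transposition handles (hi, lo).  Summing up,
   v(m+2) = 2 v(m+1) + 2 (v(m) + 1).  The convention v(0) = 0 is what makes this
   correct for m = 0, where the two options of the last cases coincide. *)

Require Import Defs.
From mathcomp Require Import all_boot all_order all_algebra.
From mathcomp Require Import classical_sets fsbigop.
From mathcomp Require Import zify ring.
Set Implicit Arguments.
Unset Strict Implicit.
Unset Printing Implicit Defensive.
Import GRing.Theory Num.Theory.
Local Open Scope ring_scope.

(** * Admissible operations and their transposes *)

Section Operations.

Local Open Scope nat_scope.

Definition admissible n : {set operation n} :=
  [set F | [&& op_associative F, quasitrivial F & order_preserving F]].

Lemma admissibleP n (F : operation n) :
  reflect [/\ forall x y z, F (F (x, y), z) = F (x, F (y, z)),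
              forall x y, F (x, y) = x \/ F (x, y) = y &
              forall x x' y y' : 'I_n, x <= x' -> y <= y' ->
                F (x, y) <= F (x', y')]
          (F \in admissible n).
Proof.
rewrite inE; apply: (iffP and3P) => [] [Fa Fq Fm]; split.
- by move=> x y z; apply/eqP; move: Fa => /forallP/(_ x)/forallP/(_ y)/forallP.
- move=> x y; move: Fq => /forallP/(_ x)/forallP/(_ y).
  by case/orP=> /eqP ->; [left | right].
- move=> x x' y y' lex ley.
  move: Fm => /forallP/(_ x)/forallP/(_ x')/forallP/(_ y)/forallP/(_ y').
  by rewrite lex ley.
- by do 3!apply/forallP => ?; rewrite Fa.
- apply/forallP => x; apply/forallP => y; apply/orP.
  by case: (Fq x y) => ->; rewrite eqxx; [left | right].
- by do 4!apply/forallP => ?; apply/implyP => /andP[]; apply: Fm.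
Qed.

Lemma admissible_fst n : [ffun p => p.1] \in admissible n.
Proof. by apply/admissibleP; split=> [x y z|x y|x x' y y']; rewrite !ffunE //; left. Qed.

Lemma card_admissible0 : #|admissible 0| = 1.
Proof.
have /eq_card -> : admissible 0 =i predT.
  by move=> F; rewrite [RHS]inE; apply/admissibleP; split; case.
by rewrite card_ffun card_prod !card_ord.
Qed.

Lemma v_admissible n : v n.+1 = #|admissible n.+1|.
Proof. by rewrite /v /admissible cardsE. Qed.

Definition transpose n (F : operation n) : operation n :=
  [ffun p => F (p.2, p.1)].

Lemma transposeE n (F : operation n) x y : transpose F (x, y) = F (y, x).
Proof. by rewrite ffunE. Qed.

Lemma transposeK n : involutive (@transpose n).
Proof. by move=> F; apply/ffunP => -[x y]; rewrite !transposeE. Qed.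

Lemma admissible_transpose n (F : operation n) :
  (transpose F \in admissible n) = (F \in admissible n).
Proof.
wlog suff imp : F / F \in admissible n -> transpose F \in admissible n.
  by apply/idP/idP => /imp //; rewrite transposeK.
move=> /admissibleP[Fa Fq Fm]; apply/admissibleP.
split=> [x y z|x y|x x' y y' lex ley]; rewrite !transposeE ?Fa //.
- by case: (Fq y x); [right | left].
- exact: Fm.
Qed.

(** * Extending an operation by a class of maximal rank *)

(* [f] identifies 'I_k with the elements of 'I_n that are not of maximal rank
   in the weak order describing the operation; [g x = None] means that [x] has
   maximal rank. *)
Section Extension.

Variables (k n : nat) (f : 'I_k -> 'I_n) (g : 'I_n -> option 'I_k).
Hypothesis fK : pcancel f g.
Hypothesis gK : ocancel g f.
Hypothesis f_mono : {mono f : i j / i <= j}.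
Hypothesis g_lo : forall x i, g x = None -> x <= f i -> forall z : 'I_n, x <= z.
Hypothesis g_hi : forall x i, g x = None -> f i <= x -> forall z : 'I_n, z <= x.

(** On the class of maximal rank [F] is the first projection, and this class absorbs everything of
    lower rank from both sides. *)
Definition dominated (F : operation n) :=
  [forall x, forall y,
     ((g x == None) ==> (F (x, y) == x)) &&
     ((g x != None) && (g y == None) ==> (F (x, y) == y))].

Definition extend (G : operation k) : operation n :=
  [ffun p => if g p.1 is Some i
             then if g p.2 is Some j then f (G (i, j)) else p.2
             else p.1].

(** For quasitrivial [F] the value is one of the two arguments, hence in the image of [f]; the
    default [p.1] only makes the definition total. *)
Definition restrict (F : operation n) : operation k :=
  [ffun p => odflt p.1 (g (F (f p.1, f p.2)))].

Lemma f_inj : injective f. Proof. exact: pcan_inj fK. Qed.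

Variant rank_spec (x : 'I_n) : option 'I_k -> Type :=
  | RankSome i of x = f i : rank_spec x (Some i)
  | RankNone of g x = None : rank_spec x None.

Lemma rankP x : rank_spec x (g x).
Proof. by case gx: (g x) (gK x) => [i|] /= fi; constructor. Qed.

Lemma extend_None G x y : g x = None -> extend G (x, y) = x.
Proof. by move=> gx; rewrite ffunE /= gx. Qed.

Lemma extend_SomeNone G i y : g y = None -> extend G (f i, y) = y.
Proof. by move=> gy; rewrite ffunE /= fK gy. Qed.

Lemma extend_Some G i j : extend G (f i, f j) = f (G (i, j)).
Proof. by rewrite ffunE /= !fK. Qed.

Definition extendE := (extend_Some, extend_SomeNone, extend_None).

Lemma extend_inj : injective extend.
Proof.
move=> G H eqGH; apply/ffunP => -[i j]; apply: f_inj.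
by rewrite -!extend_Some eqGH.
Qed.

Lemma extend_dominated G : dominated (extend G).
Proof.
apply/forallP => x; apply/forallP => y; apply/andP; split.
  by apply/implyP => /eqP gx; rewrite extendE.
apply/implyP => /andP[+ /eqP gy].
by case: (rankP x) => [i -> _|gx]; rewrite ?eqxx // !extendE.
Qed.

(** Associativity: if some argument has maximal rank, both bracketings return the leftmost such one.
    Monotonicity: when a comparison mixes the two ranks, [g_lo] and [g_hi] make the element of
    maximal rank an endpoint of the chain. *)
Lemma extend_admissible G : G \in admissible k -> extend G \in admissible n.
Proof.
move=> /admissibleP[Ga Gq Gm]; apply/admissibleP; split.
- move=> x y z; case: (rankP x) => [i ->|gx]; last first.
    by rewrite !(extend_None _ _ gx).
  case: (rankP y) => [j ->|gy]; last first.
    by rewrite !(extend_None _ _ gy, extend_SomeNone _ _ gy).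
  case: (rankP z) => [l ->|gz]; last first.
    by rewrite !(extend_Some, extend_SomeNone _ _ gz).
  by rewrite !extend_Some Ga.
- move=> x y; case: (rankP x) => [i ->|gx]; last by left; rewrite extendE.
  case: (rankP y) => [j ->|gy]; last by right; rewrite extendE.
  by rewrite extendE; case: (Gq i j) => ->; [left | right].
- move=> x x' y y'.
  case: (rankP x) => [i ->|gx]; case: (rankP x') => [i' ->|gx'] lex ley.
  + case: (rankP y) ley => [j ->|gy]; case: (rankP y') => [j' ->|gy'] ley;
      rewrite !extendE //.
    * by rewrite f_mono Gm // -f_mono.
    * exact: g_hi gy' ley _.
    * exact: g_lo gy ley _.
  + by rewrite (extend_None _ _ gx'); apply: g_hi gx' lex _.
  + by rewrite (extend_None _ _ gx); apply: g_lo gx lex _.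
  + by rewrite !extendE.
Qed.

Lemma restrictE F i j : F \in admissible n -> f (restrict F (i, j)) = F (f i, f j).
Proof.
by case/admissibleP => _ Fq _; rewrite ffunE /=; case: (Fq (f i) (f j)) => ->; rewrite fK.
Qed.

Lemma restrict_admissible F : F \in admissible n -> restrict F \in admissible k.
Proof.
move=> FS; have [Fa Fq Fm] := admissibleP _ FS; apply/admissibleP; split.
- by move=> x y z; apply: f_inj; rewrite !restrictE.
- move=> x y; case: (Fq (f x) (f y)); rewrite -restrictE // => /f_inj ->; tauto.
- by move=> x x' y y' lex ley; rewrite -f_mono !restrictE // Fm ?f_mono.
Qed.

Lemma restrictK F :
  F \in admissible n -> dominated F -> extend (restrict F) = F.
Proof.
move=> FS /forallP Fd; apply/ffunP => -[x y].
have /andP[/implyP Fx /implyP Fy] := forallP (Fd x) y.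
case: (rankP x) Fx Fy => [i ->|gx] Fx Fy; last by rewrite extendE ?(eqP (Fx _)).
case: (rankP y) Fy => [j ->|gy] Fy; first by rewrite extendE // restrictE.
by rewrite extendE // (eqP (Fy _)).
Qed.

Lemma card_dominated :
  #|[set F in admissible n | dominated F]| = #|admissible k|.
Proof.
rewrite -(card_imset _ extend_inj); apply: eq_card => F; rewrite inE.
apply/andP/imsetP => [[FS Fd]|[G GS ->]].
  by exists (restrict F); rewrite ?restrict_admissible ?restrictK.
by rewrite extend_admissible ?extend_dominated.
Qed.

End Extension.

(** * Counting by the values at the two endpoints *)

Section Recurrence.

Variable m : nat.
Notation lo := (ord0 : 'I_m.+2).
Notation hi := (ord_max : 'I_m.+2).
Notation hi' := (ord_max : 'I_m.+1).

Let le_hi (x : 'I_m.+2) : x <= hi. Proof. by rewrite -ltnS. Qed.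

Lemma unliftK k (h : 'I_k) : ocancel (unlift h) (lift h).
Proof. by move=> x; case: unliftP. Qed.

Lemma lift_mono k (h : 'I_k) : {mono lift h : i j / i <= j}.
Proof. by move=> i j; rewrite leq_bump2. Qed.

(** Here [lo] alone has maximal rank: monotonicity gives [F (lo, y) <= F (lo, hi) = lo] and
    [F (x, lo) <= F (hi, lo) = lo]. *)
Lemma card_absorbing_lo :
  #|[set F in admissible m.+2 | (F (lo, hi) == lo) && (F (hi, lo) == lo)]|
  = #|admissible m.+1|.
Proof.
rewrite -(@card_dominated _ _ (lift lo) (unlift lo)).
- apply: eq_card => F; rewrite inE [RHS]inE; apply: andb_id2l => /admissibleP[_ _ Fm].
  apply/andP/forallP => [[/eqP Flh /eqP Fhl] x|Fd]; last first.
    have := forallP (Fd lo) hi; rewrite unlift_none /= => /andP[-> _].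
    have := forallP (Fd hi) lo; rewrite unlift_none /=.
    by case: unliftP => [j _|/eqP //] /=.
  apply/forallP => y; apply/andP; split.
    apply/implyP; case: unliftP => // -> _.
    by rewrite -val_eqE /= -leqn0 -[0]/(nat_of_ord lo) -{2}Flh Fm ?le_hi.
  apply/implyP => /andP[_]; case: (unliftP _ y) => // -> _.
  by rewrite -val_eqE /= -leqn0 -[0]/(nat_of_ord lo) -{2}Fhl Fm ?le_hi.
- exact: liftK.
- exact: unliftK.
- exact: lift_mono.
- by move=> x i; case: unliftP => // ->.
- by move=> x i; case: unliftP => // ->.
Qed.

Lemma card_absorbing_hi :
  #|[set F in admissible m.+2 | (F (lo, hi) == hi) && (F (hi, lo) == hi)]|
  = #|admissible m.+1|.
Proof.
rewrite -(@card_dominated _ _ (lift hi) (unlift hi)).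
- apply: eq_card => F; rewrite inE [RHS]inE; apply: andb_id2l => /admissibleP[_ _ Fm].
  apply/andP/forallP => [[/eqP Flh /eqP Fhl] x|Fd]; last first.
    have := forallP (Fd hi) lo; rewrite unlift_none /= => /andP[-> _].
    have := forallP (Fd lo) hi; rewrite unlift_none /=.
    by case: unliftP => [j _|/eqP //] /=.
  apply/forallP => y; apply/andP; split.
    apply/implyP; case: unliftP => // -> _.
    by rewrite -val_eqE eqn_leq le_hi -{1}Fhl Fm ?le_hi.
  apply/implyP => /andP[_]; case: (unliftP _ y) => // -> _.
  by rewrite -val_eqE eqn_leq le_hi -{1}Flh Fm ?le_hi.
- exact: liftK.
- exact: unliftK.
- exact: lift_mono.
- by move=> x i; case: unliftP => // -> _; rewrite lift_max leqNgt ltn_ord.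
- by move=> x i; case: unliftP => // ->.
Qed.

(** The shift of [i] to [i + 1], whose image is the chain without its endpoints. *)
Definition inner_lift (i : 'I_m) : 'I_m.+2 := lift lo (lift hi' i).
Definition inner_unlift (x : 'I_m.+2) : option 'I_m :=
  obind (unlift hi') (unlift lo x).

Lemma inner_liftK : pcancel inner_lift inner_unlift.
Proof. by move=> i; rewrite /inner_unlift !liftK /= liftK. Qed.

Lemma inner_unliftK : ocancel inner_unlift inner_lift.
Proof.
move=> x; rewrite /inner_unlift; case: unliftP => //= j ->.
by case: unliftP => //= i ->.
Qed.

Lemma inner_unlift_None x : (inner_unlift x == None) = (x == lo) || (x == hi).
Proof.
rewrite /inner_unlift; case: (unliftP lo x) => [j|] ->; last by rewrite eqxx.
have -> : hi = lift lo hi' by apply: val_inj.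
rewrite (inj_eq lift_inj) [lift lo j == lo]eq_sym (negPf (neq_lift _ _)) /=.
by case: unliftP => [i|] -> /=; rewrite ?eqxx // [RHS]eq_sym (negPf (neq_lift _ _)).
Qed.

Lemma inner_lift_lt_hi i : inner_lift i < hi.
Proof. by rewrite /inner_lift lift0 lift_max ltnS. Qed.

Lemma card_inner_dominated :
  #|[set F in admissible m.+2 | dominated inner_unlift F]| = #|admissible m|.
Proof.
apply: (@card_dominated _ _ inner_lift).
- exact: inner_liftK.
- exact: inner_unliftK.
- by move=> i j; rewrite !lift_mono.
- move=> x i /eqP; rewrite inner_unlift_None => /orP[] /eqP -> //.
  by rewrite leqNgt inner_lift_lt_hi.
- by move=> x i /eqP; rewrite inner_unlift_None => /orP[] /eqP -> //.
Qed.

(** An inner [i] would need [F (i, lo) = lo], whereas the projection gives [i]. This decides whether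
    the two options for left zeros overlap. *)
Lemma inner_dominated_fst :
  dominated inner_unlift [ffun p : 'I_m.+2 * 'I_m.+2 => p.1] = (m == 0).
Proof.
apply/idP/eqP => [/forallP Fd|m0].
  case: (posnP m) => // m_gt0; set i := inner_lift (Ordinal m_gt0).
  have := forallP (Fd i) lo; rewrite !ffunE /= inner_liftK /=.
  by rewrite inner_unlift_None eqxx.
apply/forallP => x; apply/forallP => y; rewrite ffunE /= eqxx implybT /=.
apply/implyP => /andP[+ _]; case gx: (inner_unlift x) => [i|] // _.
by have := ltn_ord i; rewrite [X in _ < X]m0.
Qed.

Lemma left_zero_dichotomy F :
  F \in admissible m.+2 -> F (lo, hi) = lo -> F (hi, lo) = hi ->
  F = [ffun p => p.1] \/ dominated inner_unlift F.
Proof.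
move=> /admissibleP[Fa Fq Fm] Flh Fhl.
have Flo y : F (lo, y) = lo.
  by apply/ord_inj/eqP; rewrite -leqn0 -[0]/(nat_of_ord lo) -{2}Flh Fm ?le_hi.
have Fhi y : F (hi, y) = hi.
  by apply/ord_inj/eqP; rewrite eqn_leq le_hi -{1}Fhl Fm ?le_hi.
(* By associativity, [F (F (x, lo), hi) = F (x, F (lo, hi)) = F (x, lo)]; the converse is
   similar. *)
have lo_hi x : F (x, lo) = x -> F (x, hi) = x.
  by move=> Fx; rewrite -{1}Fx Fa Flh.
have hi_lo x : F (x, hi) = x -> F (x, lo) = x.
  by move=> Fx; rewrite -{1}Fx Fa Fhl.
have [Fx|] := boolP [forall x, F (x, lo) == x].
  (* Squeeze: [x = F (x, lo) <= F (x, y) <= F (x, hi) = x]. *)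
  left; apply/ffunP => -[x y]; rewrite ffunE /=.
  have Fxlo := eqP (forallP Fx x); apply/ord_inj/eqP.
  by rewrite eqn_leq -{2}(lo_hi x Fxlo) -{3}Fxlo !Fm ?le_hi.
rewrite negb_forall => /existsP[y /eqP Fy]; right.
have Fylo : F (y, lo) = lo by case: (Fq y lo).
have Fyhi : F (y, hi) = hi by case: (Fq y hi) => // /hi_lo.
(* The single witness [y] controls every [x]: below [y], [F (x, lo) <= F (y, lo) = lo]; above [y],
   [F (x, lo) = x] would give [hi = F (y, hi) <= F (x, hi) = x]. *)
have Fxlo x : x != hi -> F (x, lo) = lo.
  move=> xhi; case: (Fq x lo) => // Fx; case: (leqP x y) => [xy|/ltnW yx].
    by apply/ord_inj/eqP; rewrite -leqn0 -[0]/(nat_of_ord lo) -{2}Fylo Fm.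
  case/eqP: xhi; apply/ord_inj/eqP.
  by rewrite eqn_leq le_hi -{1}Fyhi -(lo_hi x Fx) Fm.
have Fxhi x : x != lo -> F (x, hi) = hi.
  move=> xlo; have [->|xhi] := eqVneq x hi; first exact: Fhi.
  by case: (Fq x hi) => // /hi_lo Fx; rewrite -Fx Fxlo ?eqxx in xlo.
apply/forallP => x; apply/forallP => y'; rewrite !inner_unlift_None.
apply/andP; split; first by apply/implyP => /orP[] /eqP ->; rewrite ?Flo ?Fhi.
by apply/implyP; rewrite negb_or => /andP[/andP[xlo xhi]] /orP[] /eqP ->;
  rewrite ?Fxlo ?Fxhi.
Qed.

Lemma card_left_zero :
  #|[set F in admissible m.+2 | (F (lo, hi) == lo) && (F (hi, lo) == hi)]|
  = (v m).+1.
Proof.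
set A := [set F in admissible m.+2 | dominated inner_unlift F].
pose fst : operation m.+2 := [ffun p => p.1].
transitivity #|fst |: A|.
  apply: eq_card => F; rewrite !inE; apply/andP/orP.
    case=> FS /andP[/eqP Flh /eqP Fhl].
    have FS' : F \in admissible m.+2 by rewrite inE.
    have [->|Fd] := left_zero_dichotomy FS' Flh Fhl; first by left.
    by right; rewrite FS.
  case=> [/eqP ->|/andP[FS /forallP Fd]].
    by have := admissible_fst m.+2; rewrite inE => ->; rewrite !ffunE !eqxx.
  have := forallP (Fd lo) hi; have := forallP (Fd hi) lo.
  by rewrite !inner_unlift_None !eqxx /= => /andP[-> _] /andP[-> _].
rewrite cardsU1 card_inner_dominated inE admissible_fst inner_dominated_fst.
(* For [m = 0] the projection already lies in [A], which has one element, so the count is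
   [1 = v 0 + 1]; otherwise the union is disjoint. *)
case: m => [|m'] /=; first by rewrite card_admissible0.
by rewrite -v_admissible.
Qed.

(** Transposition exchanges the values at [(lo, hi)] and [(hi, lo)]. *)
Lemma card_right_zero :
  #|[set F in admissible m.+2 | (F (lo, hi) == hi) && (F (hi, lo) == lo)]|
  = (v m).+1.
Proof.
rewrite -card_left_zero -(card_imset _ (inv_inj (@transposeK m.+2))).
apply: eq_card => F; rewrite [RHS]inE.
apply/imsetP/and3P => [[G + ->]|[FS Fhl Flh]].
  by case/setIdP => GS /andP[Glh Ghl]; rewrite admissible_transpose !transposeE.
exists (transpose F); last by rewrite transposeK.
by apply/setIdP; rewrite admissible_transpose !transposeE FS Fhl Flh.
Qed.

Lemma v_recurrence : v m.+2 = 2 * v m.+1 + 2 * v m + 2.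
Proof.
pose L := [set F : operation m.+2 | F (lo, hi) == lo].
pose H := [set F : operation m.+2 | F (hi, lo) == lo].
have memL F : (F \in L) = (F (lo, hi) == lo) by rewrite inE.
have memH F : (F \in H) = (F (hi, lo) == lo) by rewrite inE.
have hi_lo F : F \in admissible m.+2 ->
    (F (lo, hi) == hi) = ~~ (F (lo, hi) == lo) /\
    (F (hi, lo) == hi) = ~~ (F (hi, lo) == lo).
  by move=> /admissibleP[_ Fq _]; split;
    [case: (Fq lo hi) | case: (Fq hi lo)] => -> ; rewrite -!val_eqE /= ?eqxx.
(* Membership in [L] and in [H] splits the admissible operations into the four endpoint classes. *)
rewrite v_admissible -(cardsID L) -(cardsID H (_ :&: L)) -(cardsID H (_ :\: L)).
transitivity (v m.+1 + (v m).+1 + ((v m).+1 + v m.+1)); last by lia.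
congr (_ + _ + (_ + _)).
- rewrite v_admissible -card_absorbing_lo; apply: eq_card => F.
  by rewrite !finset.in_setI memL memH [RHS]inE andbA.
- rewrite -card_left_zero; apply: eq_card => F.
  rewrite finset.in_setD finset.in_setI memL memH [RHS]inE andbC -andbA.
  by apply: andb_id2l => /hi_lo[_ ->].
- rewrite -card_right_zero; apply: eq_card => F.
  rewrite finset.in_setI finset.in_setD memL memH [RHS]inE [_ && (F \in _)]andbC -andbA.
  by apply: andb_id2l => /hi_lo[-> _].
- rewrite v_admissible -card_absorbing_hi; apply: eq_card => F.
  rewrite !finset.in_setD memL memH [RHS]inE andbC [_ && (F \in _)]andbC -andbA.
  by apply: andb_id2l => /hi_lo[-> ->].
Qed.

End Recurrence.

Lemma v1 : v 1 = 1.
Proof.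
rewrite v_admissible; apply/eqP/cards1P; exists [ffun p => p.1].
apply/setP => F; rewrite finset.in_set1; apply/idP/eqP => [_|->].
  by apply/ffunP => -[x y]; rewrite [LHS]ord1 [RHS]ord1.
exact: admissible_fst.
Qed.

End Operations.

(** * Closed form and binomial sum *)

Lemma expr1D_even_odd (R : comNzRingType) (x : R) n :
  (1 + x) ^+ n = \sum_(k < n.+1) (x ^+ 2) ^+ k * 'C(n, 2 * k)%:R
                 + (\sum_(k < n.+1) (x ^+ 2) ^+ k * 'C(n, (2 * k).+1)%:R) * x.
Proof.
pose p : {poly R} := \poly_(i < n.+1) 'C(n, i)%:R.
have coefp i : p`_i = 'C(n, i)%:R.
  by rewrite coef_poly; case: ltnP => // /bin_small ->.
have szp : (size p <= n.+1)%N by exact: size_poly.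
have -> : (1 + x) ^+ n = p.[x].
  rewrite (horner_coef_wide _ szp) exprDn; apply: eq_bigr => i _.
  by rewrite expr1n mul1r coefp mulr_natl.
(* Even and odd parts: [p(x) = p_even(x^2) + p_odd(x^2) * x]. Both sums are then padded with zero
   terms to [n.+1]. *)
rewrite -[in LHS](poly_even_odd p) !hornerE !horner_comp !hornerE.
rewrite !(@horner_coef_wide _ n.+1).
- congr (_ + _ * _); apply: eq_bigr => k _; rewrite mulrC.
    by rewrite coef_even_poly coefp mul2n.
  by rewrite coef_odd_poly coefp mul2n.
- by apply: leq_trans (size_odd_poly _) _; move: (size p) szp => sz; lia.
- by apply: leq_trans (size_even_poly _) _; move: (size p) szp => sz; lia.
Qed.

Lemma binomial_sqrt3 (R : rcfType) n :
  (2 + Num.sqrt 3) / 2 * (1 + Num.sqrt 3) ^+ n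
    + (2 - Num.sqrt 3) / 2 * (1 - Num.sqrt 3) ^+ n
  = \sum_(k < n.+1)
      (3 ^+ k * (2 * 'C(n, 2 * k)%:R + 3 * 'C(n, (2 * k).+1)%:R) : R).
Proof.
set s := Num.sqrt 3; have s2 : s ^+ 2 = 3 by rewrite sqr_sqrtr.
under eq_bigr => k _ do rewrite mulrDr mulrCA [3 ^+ k * (3 * _)]mulrCA.
rewrite big_split /= -!mulr_sumr !expr1D_even_odd sqrrN s2.
(* The powers are [E + O * s] and [E - O * s]; the terms odd in [s] cancel, leaving
   [2 * E + 3 * O]. *)
set E := \sum_(k < _) _; set O := \sum_(k < _) _.
by field : s2.
Qed.

Lemma v_closed_form (R : rcfType) n :
  3 * (v n)%:R + 2
  = (2 + Num.sqrt 3) / 2 * (1 + Num.sqrt 3) ^+ n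
    + (2 - Num.sqrt 3) / 2 * (1 - Num.sqrt 3) ^+ n :> R.
Proof.
set s := Num.sqrt 3; have s2 : s ^+ 2 = 3 by rewrite sqr_sqrtr.
(* The recurrence has order two, so the induction carries two consecutive indices. *)
have [//] : (3 * (v n)%:R + 2
    = (2 + s) / 2 * (1 + s) ^+ n + (2 - s) / 2 * (1 - s) ^+ n) /\
  (3 * (v n.+1)%:R + 2
    = (2 + s) / 2 * (1 + s) ^+ n.+1 + (2 - s) / 2 * (1 - s) ^+ n.+1).
elim: n => [|n [IH0 IH1]]; first by rewrite v1 [v 0]/=; split; field : s2.
split=> //; rewrite v_recurrence !(natrM, natrD).
(* [3 v + 2] satisfies the homogeneous recurrence, whose characteristic roots, those of
   [t^2 = 2 t + 2], are [1 + s] and [1 - s]. *)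
transitivity (2 * (3 * (v n.+1)%:R + 2) + 2 * (3 * (v n)%:R + 2) : R).
  by ring.
by rewrite IH0 IH1 !exprS; field : s2.
Qed.

Lemma fsbig_nat_ord (R : nmodType) n (F : nat -> R) :
  (forall k, (n <= k)%N -> F k = 0) ->
  \sum_(k \in [set: nat]%classic) F k = \sum_(k < n) F k.
Proof.
move=> F0; rewrite fsbig_ord; apply/esym/fsbig_widen => // k [_ /negP].
by rewrite -leqNgt; apply: F0.
Qed.

(** * Formal power series and the generating function *)

Definition fps_trunc (A : nzRingType) N (a : fps A) : {poly A} :=
  \poly_(i < N) a i.

Lemma coef_fps_trunc (A : nzRingType) N (a : fps A) i :
  (i < N)%N -> (fps_trunc N a)`_i = a i.
Proof. by rewrite coef_poly => ->. Qed.

(** Coefficient [n] of a product involves only coefficients up to [n], so ring laws transfer from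
    polynomials. *)
Lemma fps_mul_trunc (A : nzRingType) N (a b : fps A) n :
  (n < N)%N -> fps_mul a b n = (fps_trunc N a * fps_trunc N b)`_n.
Proof.
move=> ltnN; rewrite coefM; apply: eq_bigr => i _.
by have lt_in := ltn_ord i; rewrite !coef_fps_trunc //; lia.
Qed.

Lemma eq_fps_mul (A : nzRingType) (a a' b b' : fps A) :
  a =1 a' -> b =1 b' -> fps_mul a b =1 fps_mul a' b'.
Proof. by move=> aa' bb' n; apply: eq_bigr => i _; rewrite aa' bb'. Qed.

Lemma fps_mulC (A : comNzRingType) (a b : fps A) : fps_mul a b =1 fps_mul b a.
Proof. by move=> n; rewrite !(fps_mul_trunc _ _ (ltnSn n)) mulrC. Qed.

Lemma fps_mulA (A : nzRingType) (a b c : fps A) :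
  fps_mul a (fps_mul b c) =1 fps_mul (fps_mul a b) c.
Proof.
move=> n; pose T := @fps_trunc A n.+1.
transitivity ((T a * (T b * T c))`_n).
  rewrite coefM; apply: eq_bigr => i _.
  by rewrite coef_fps_trunc // (@fps_mul_trunc _ n.+1) // ltnS leq_subr.
rewrite mulrA coefM; apply: eq_bigr => i _.
by rewrite -fps_mul_trunc // coef_fps_trunc // ltnS leq_subr.
Qed.

Lemma fps_mulr1 (A : nzRingType) (a : fps A) :
  fps_mul a (fps_of_poly 1) =1 a.
Proof.
move=> n; rewrite /fps_mul big_ord_recr /= subnn /fps_of_poly coef1 mulr1.
rewrite big1 ?add0r // => i _.
by rewrite coef1 subn_eq0 leqNgt ltn_ord mulr0.
Qed.

(** Multiply by the inverse: [c = c * (b * b^-1) = (c * b) * b^-1 = a * b^-1]. *)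
Lemma fps_divP (A : comUnitRingType) (a b c : fps A) :
  b 0%N \is a GRing.unit -> fps_mul c b =1 a -> c =1 fps_div a b.
Proof.
move=> b0U cba n; rewrite /fps_div -(eq_fps_mul cba (fun=> erefl)) -fps_mulA.
rewrite -[LHS]fps_mulr1; apply: eq_fps_mul => // i.
by rewrite fps_mulC fps_mulVr.
Qed.

(** The denominator is [(1 - z) * (1 - 2 z - 2 z^2)]: the second factor encodes the recurrence and
    [1 - z] removes its constant term [2] from degree 3 on. *)
Lemma generating_function_recurrence (w : nat -> nat) :
  w 0 = 0%N -> w 1 = 1%N ->
  (forall m, w m.+2 = 2 * w m.+1 + 2 * w m + 2)%N ->
  fps_mul (generating_function w) (fps_of_poly (2 *: 'X^3 - 3 *: 'X + 1))
  =1 fps_of_poly ('X * ('X + 1)).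
Proof.
move=> w0 w1 wrec n; pose W := fps_trunc n.+1 (generating_function w).
transitivity (W * (2 *: 'X^3 - 3 *: 'X + 1))`_n.
  by rewrite coefM; apply: eq_bigr => i _; rewrite coef_fps_trunc.
rewrite /fps_of_poly !mulrDr !mulr1 mulrN -!scalerAr.
rewrite !(coefD, coefN, coefZ, coefMX, coefMXn, coefX) !coef_poly.
rewrite /generating_function; case: n @W => [|[|[|n]]] _ /=.
- by rewrite w0.
- by rewrite w0 w1.
- by rewrite wrec w0 w1.
have -> : (n.+3 - 3 = n)%N by lia.
rewrite !ifT; [|lia..].
(* Subtracting consecutive instances of the recurrence gives [w (n+3) - 3 w (n+2) + 2 w n = 0]. *)
by rewrite (wrec n.+1) (wrec n) !(PoszM, PoszD); ring.
Qed.

Theorem proposition4p11 (R : rcfType) :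
  [/\ forall n : nat, (v n.+2)%:Z - 2 * (v n.+1)%:Z - 2 * (v n)%:Z = 2,
      v 0 = 0%N /\ v 1 = 1%N,
      forall n : nat,
        (3 * (v n)%:R + 2 : R)
          = (2 + Num.sqrt 3) / 2 * (1 + Num.sqrt 3) ^+ n
            + (2 - Num.sqrt 3) / 2 * (1 - Num.sqrt 3) ^+ n
        /\ (2 + Num.sqrt 3) / 2 * (1 + Num.sqrt 3) ^+ n
            + (2 - Num.sqrt 3) / 2 * (1 - Num.sqrt 3) ^+ n
          = \sum_(k \in [set: nat]%classic)
              (3 ^+ k * (2 * 'C(n, 2 * k)%:R + 3 * 'C(n, (2 * k).+1)%:R) : R)
    & generating_function v =1
        fps_div (fps_of_poly ('X * ('X + 1)))
                (fps_of_poly (2 *: 'X^3 - 3 *: 'X + 1))].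
Proof.
split.
- by move=> n; rewrite v_recurrence !(PoszM, PoszD); ring.
- by split; rewrite ?v1.
- move=> n; split; first exact: v_closed_form.
  rewrite binomial_sqrt3 (@fsbig_nat_ord _ n.+1) // => k ltnk.
  (* For [k > n] both lower indices exceed [n], so the infinite sum has finite support. *)
  by rewrite !bin_small ?mulr0 ?addr0 ?mulr0 //; lia.
apply: fps_divP.
  (* The denominator has constant coefficient 1, hence is invertible over the integers. *)
  rewrite /fps_of_poly !(coefD, coefN, coefZ, coefX, coefXn, coef1) /=.
  by rewrite !mulr0 oppr0 !add0r unitr1.
exact: generating_function_recurrence v1 v_recurrence.
Qed.
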